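(* Any (uniform or non-uniform) CNF solving the promise Group Isomorphism problem on multiplication tables of groups of order $n=2^{2k}$ has size at least $n^{\Omega(\log n)}$ (where $\Omega$ is as $k\to\infty$, with an absolute implied constant).
   Context: A group of order $n$ with underlying set $[n]$ is given by its $n\times n$ multiplication (Cayley) table, each entry encoded by $\lceil\log_2 n\rceil$ bits. Promise Group Isomorphism: the input is a pair of $n\times n$ tables promised to be multiplication tables of groups; the CNF must output $1$ if the two groups are isomorphic and $0$ if they are not; its behavior on inputs violating the promise is unconstrained. The size of a CNF is its number of clauses. *)

(* Defs.v *)
From mathcomp Require Import all_boot all_algebra.

Set Implicit Arguments.
Unset Strict Implicit.
Unset Printing Implicit Defensive.

Section Cnf.

Variable V : finType.

(* The literal (v, true) is v and (v, false) is its negation. *)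
Definition literal : finType := (V * bool)%type.
Definition clause : finType := {set literal}.
Definition cnf : finType := {set clause}.

Definition clause_eval (C : clause) (a : V -> bool) : bool :=
  [exists l in C, a l.1 == l.2].

Definition cnf_eval (F : cnf) (a : V -> bool) : bool :=
  [forall C in F, clause_eval C a].

(* Clauses form a set, so repeated clauses are not counted. *)
Definition cnf_size (F : cnf) : nat := #|F|.

End Cnf.

Section GroupTables.

Variable n : nat.

(* The underlying set [n] is represented as {0, ..., n-1}. *)
Definition table : Type := 'M['I_n]_n.

Definition is_group_table (t : table) : Prop :=
  exists (e : 'I_n) (inv : 'I_n -> 'I_n),
    [/\ associative t, left_id e t, right_id e t,
        left_inverse e inv t & right_inverse e inv t].

Definition isomorphic (t1 t2 : table) : Prop :=
  exists f : 'I_n -> 'I_n,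
    bijective f /\ forall x y, f (t1 x y) = t2 (f x) (f y).

(* (s, x, y, i) is the i-th bit of the entry (x, y) of the first (s = false)
   or second (s = true) table; up_log 2 n is the ceiling of log_2 n. *)
Definition gi_var : finType := (bool * 'I_n * 'I_n * 'I_(up_log 2 n))%type.

Definition bit (m i : nat) : bool := odd (m %/ 2 ^ i).

Definition encode (t1 t2 : table) (v : gi_var) : bool :=
  let: (s, x, y, i) := v in bit ((if s then t2 else t1) x y) i.

Definition solves_group_iso (F : cnf gi_var) : Prop :=
  forall t1 t2 : table, is_group_table t1 -> is_group_table t2 ->
    cnf_eval F (encode t1 t2) <-> isomorphic t1 t2.

End GroupTables.

(* Main.v *)
(** Fix the second table to be the group B = Z_2^2 x Z_4^(k-1) and let the first
    one be A = Z_4^k under labellings that swap, independently at random, the two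
    elements of each coset of an order-2 subgroup <w>, where a and a + w carry
    bitwise complementary labels.  Modulo w nothing is random, so every bit of
    the entry for (a, b) is a constant plus t(a) + t(b) + t(a + b) over F_2, where
    t records the swaps.  If one can find r literals of a clause, each involving a
    coset that the previous ones do not, then the clause is falsified with
    probability at most 2^-r.  Otherwise all the equations of the clause live on a
    set S of O(r) elements.  In that case a generic homomorphism A -> Z_4^(k-1)
    is injective on S and lifts to a bijection A -> B respecting all the products
    the clause looks at; a clause falsified by a table of A would then also be
    falsified by a table of B, which is impossible.  Hence at least 2^r clauses
    are needed, and r = k^2 is allowed because |S|^2 = O(k^4) is below 2^(k-1). *)
From HB Require Import structures.
Require Import Defs.
From mathcomp Require Import all_boot all_order all_algebra.
From mathcomp Require Import all_classical all_reals all_analysis.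
From mathcomp Require Import ring zify.
From mathcomp Require Import fintype finset.
Import Order.TTheory GRing.Theory Num.Theory.
Local Open Scope ring_scope.

Set Implicit Arguments.
Unset Strict Implicit.
Unset Printing Implicit Defensive.

(** * Complementary labels and halving by flips *)

(** Complementing turns the quotient [q] of [j] by [2 ^ i] into [2 ^ (K - i) - 1 - q], of opposite
    parity because [2 ^ (K - i)] is even for [i < K]. *)
Lemma bit_complement (K i j : nat) :
  (i < K)%N -> (j < 2 ^ K)%N -> bit (2 ^ K - j.+1) i = ~~ bit j i.
Proof.
move=> ltiK ltj; rewrite /bit.
have e0 : (2 ^ K = 2 ^ (K - i) * 2 ^ i)%N by rewrite -expnD subnK // ltnW.
have p0 : (0 < 2 ^ i)%N by rewrite expn_gt0.
have hq : (j %/ 2 ^ i < 2 ^ (K - i))%N by rewrite ltn_divLR // -e0.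
have hr := ltn_pmod j p0.
have -> : (2 ^ K - j.+1 =
  (2 ^ (K - i) - (j %/ 2 ^ i).+1) * 2 ^ i + (2 ^ i - (j %% 2 ^ i).+1))%N.
  rewrite e0 {1}(divn_eq j (2 ^ i)) mulnBl mulSn.
  have := leq_mul hq (leqnn (2 ^ i)); rewrite mulSn.
  move: (2 ^ (K - i) * 2 ^ i)%N (j %/ 2 ^ i * 2 ^ i)%N hr => u1 u2.
  move: (2 ^ i)%N => u3; lia.
rewrite divnMDl // (divn_small (m := (2 ^ i - _)%N)) ?addn0; last first.
  by lia.
rewrite oddB //= oddX addbC.
have -> : (K - i == 0)%N = false by rewrite subn_eq0 leqNgt ltiK.
by rewrite /= addbF.
Qed.

Definition flip (A : finType) (z : A) (s : {ffun A -> bool}) : {ffun A -> bool} :=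
  [ffun a => s a (+) (a == z)].

Lemma flipK (A : finType) (z : A) : involutive (flip z).
Proof. by move=> s; apply/ffunP => a; rewrite !ffunE addbK. Qed.

(** [X] is kept invariant under flips outside [S]. If some [D i] contains a [z] outside [S], then
    [flip z] permutes [X] and negates [p i], so imposing [p i] halves [X]; adding [D i] to [S]
    restores the invariance. *)
Lemma fresh_chain (A I : finType) (C : {set I})
    (p : I -> {ffun A -> bool} -> bool) (D : I -> {set A}) (d : nat) :
  (forall i z s, p i (flip z s) = p i s (+) (z \in D i)) ->
  (forall i, #|D i| <= d)%N -> forall r : nat,
  (exists2 S : {set A}, (#|S| <= d * r)%N & forall i, i \in C -> D i \subset S)
  \/ (#|[set s | [forall i in C, p i s]]| * 2 ^ r <= 2 ^ #|A|)%N.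
Proof.
move=> pflip Dd.
suff H (r : nat) :
    (exists2 S : {set A}, (#|S| <= d * r)%N & forall i, i \in C -> D i \subset S)
    \/ exists (S : {set A}) (X : {set {ffun A -> bool}}),
      [/\ (#|S| <= d * r)%N, [set s | [forall i in C, p i s]] \subset X,
          forall z s, z \notin S -> (flip z s \in X) = (s \in X)
        & (#|X| * 2 ^ r <= 2 ^ #|A|)%N].
  move=> r; case: (H r) => [|[S [X [_ sub _ cX]]]]; [by left | right].
  by apply: leq_trans cX; rewrite leq_mul2r subset_leq_card // orbT.
elim: r => [|r [[S cS subS]|[S [X [cS sub inv cX]]]]].
- right; exists set0, [set: _]; split => //; first by rewrite cards0.
    by move=> z s _; rewrite !inE.
  by rewrite expn0 muln1 cardsT card_ffun card_bool.
- by left; exists S => //; apply: leq_trans cS _; rewrite leq_mul2l leqnSn orbT.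
case: (boolP [forall i in C, D i \subset S]) => [/forall_inP all_sub|].
  by left; exists S => //; apply: leq_trans cS _; rewrite leq_mul2l leqnSn orbT.
case/forall_inPn => i iC /subsetPn[z zD zS]; right.
exists (S :|: D i), (X :&: [set s | p i s]); split.
- by rewrite (leq_trans (leq_card_setU _ _)) // mulnS addnC leq_add.
- apply/subsetP => s s_in; rewrite inE (subsetP sub) //= inE.
  by move: s_in; rewrite inE => /forall_inP; apply.
- move=> y s; rewrite !inE negb_or => /andP[yS yD].
  by rewrite inv // pflip (negbTE yD) addbF.
- apply: leq_trans cX; rewrite expnS mulnA leq_mul2r muln2 -addnn; apply/orP; right.
  rewrite -(cardsID [set s | p i s] X) leq_add2l.
  rewrite -[leqLHS](card_imset _ (inv_inj (flipK z))) subset_leq_card //.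
  apply/subsetP => _ /imsetP[s sXp ->]; move: sXp; rewrite !inE => /andP[sX ps].
  by rewrite inv // sX pflip zD ps.
Qed.

(** In each orbit of [f] the element of smaller [enum_rank] is labelled by its index among those
    chosen, and its partner gets the mirrored label. *)
Lemma complementary_labelling (A : finType) (n : nat) (f : A -> A) :
  #|A| = n -> involutive f -> (forall a, f a != a) ->
  exists2 l : A -> 'I_n, bijective l & forall a, l (f a) = rev_ord (l a).
Proof.
move=> cA fK fN.
pose P := [set a | enum_rank a < enum_rank (f a)]%N.
have Pf a : (f a \in P) = (a \notin P).
  rewrite !inE fK -leqNgt ltn_neqAle; case: eqP => //= e.
  by have := fN a; rewrite (enum_rank_inj (val_inj e)) eqxx.
have cP : (#|P| + #|P| = n)%N.
  rewrite -cA -[in RHS](cardsC P); congr addn.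
  rewrite -(card_imset _ (inv_inj fK)); congr #|pred_of_set _|.
  apply/setP => a; rewrite inE; apply/imsetP/idP => [[b bP ->]|aP].
    by rewrite Pf negbK.
  by exists (f a); rewrite ?fK // Pf.
pose h a := index a (enum P).
have hlt a : a \in P -> (h a < #|P|)%N by rewrite /h cardE index_mem mem_enum.
have hn a : a \in P -> (h a < n)%N.
  by move=> /hlt aP; rewrite (leq_trans aP) // -cP leq_addr.
have n0 (a : A) : (0 < n)%N by rewrite -cA; apply/card_gt0P; exists a.
pose g a : nat := if a \in P then h a else (n - (h (f a)).+1)%N.
have gn a : (g a < n)%N.
  by rewrite /g; case: ifP => [/hn//|_]; rewrite ltn_subrL (n0 a).
have gf a : g (f a) = (n - (g a).+1)%N.
  rewrite /g Pf fK; case: (boolP (a \in P)) => //=; rewrite -Pf => /hn.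
  by move: (h _) => ?; lia.
have gP a : (g a < #|P|)%N = (a \in P).
  rewrite /g; case: ifP => [/hlt//|/negbT]; rewrite -Pf => /hlt aP.
  apply/negbTE; rewrite -leqNgt -cP; move: aP.
  by move=> aP; rewrite -addnBA // leq_addr.
have ginj : injective g.
  have inj1 a b : a \in P -> g a = g b -> a = b.
    move=> aP e; have bP : b \in P by rewrite -gP -e gP.
    move: e; rewrite /g aP bP => /(congr1 (nth a (enum P))).
    by rewrite !nth_index ?mem_enum.
  move=> a b e; case: (boolP (a \in P)) => [/inj1|]; first exact.
  by rewrite -Pf => /inj1 h1; apply: (inv_inj fK); apply: h1; rewrite !gf e.
exists (fun a => Ordinal (gn a)); last by move=> a; apply/val_inj; rewrite /= gf.
apply: inj_card_bij; last by rewrite card_ord cA.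
by move=> a b [/ginj].
Qed.

(** * Swaps within the cosets of an order-2 subgroup *)

Section Translation_labels.

Variables (A : finZmodType) (w : A).
Hypothesis w2 : w + w = 0.

Definition in_coset (z a : A) : bool := (a == z) || (a == z + w).

Lemma addwK (a : A) : a + w + w = a.
Proof. by rewrite -addrA w2 addr0. Qed.

Lemma in_coset_addw (z a : A) : in_coset z (a + w) = in_coset z a.
Proof.
by rewrite /in_coset (inj_eq (addIr w)) -(inj_eq (addIr w) (a + w)) addwK orbC.
Qed.

Lemma in_coset_refl (a : A) : in_coset a a. Proof. by rewrite /in_coset eqxx. Qed.

Definition mul_w (b : bool) : A := if b then w else 0.

Lemma mul_wD (b c : bool) : mul_w (b (+) c) = mul_w b + mul_w c.
Proof. by case: b c => [] [] /=; rewrite ?addr0 ?add0r ?w2. Qed.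

Lemma in_coset_mul_w (z a : A) (b : bool) : in_coset z (a + mul_w b) = in_coset z a.
Proof. by case: b => /=; rewrite ?addr0 ?in_coset_addw. Qed.

(** The swap bit of the coset of [a]: the sum is the same for [a] and [a + w], so no coset
    representatives have to be chosen. *)
Definition symm (s : {ffun A -> bool}) (a : A) : bool := s a (+) s (a + w).

Lemma symm_mul_w (s : {ffun A -> bool}) (a : A) (b : bool) :
  symm s (a + mul_w b) = symm s a.
Proof. by case: b => /=; rewrite ?addr0 // /symm addwK addbC. Qed.

Definition shift (s : {ffun A -> bool}) (a : A) : A := a + mul_w (symm s a).

Lemma shiftK (s : {ffun A -> bool}) : involutive (shift s).
Proof. by move=> a; rewrite /shift symm_mul_w -addrA -mul_wD addbb addr0. Qed.

Definition defect (s : {ffun A -> bool}) (a b : A) : bool :=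
  symm s a (+) symm s b (+) symm s (a + b).

Lemma shiftD (s : {ffun A -> bool}) (a b : A) :
  shift s (shift s a + shift s b) = a + b + mul_w (defect s a b).
Proof.
have -> : shift s a + shift s b = a + b + mul_w (symm s a (+) symm s b).
  by rewrite mul_wD /shift addrACA.
by rewrite /shift symm_mul_w -addrA -mul_wD.
Qed.

(* The coordinates of [s] that [defect s a b] depends on. *)
Definition dependency (a b : A) : {set A} :=
  [set z | in_coset z a (+) in_coset z b (+) in_coset z (a + b)].

Hypothesis w_neq0 : w != 0.

Lemma symm_flip (s : {ffun A -> bool}) (a z : A) :
  symm (flip z s) a = symm s a (+) in_coset z a.
Proof.
rewrite /symm /in_coset !ffunE -[a == z + w](inj_eq (addIr w)) addwK addbACA.
congr addb; case: eqP => [->|] //=; case: eqP => //.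
by move/eqP; rewrite -subr_eq0 addrAC subrr add0r (negbTE w_neq0).
Qed.

Lemma defect_flip (s : {ffun A -> bool}) (a b z : A) :
  defect (flip z s) a b = defect s a b (+) (z \in dependency a b).
Proof.
rewrite /defect !symm_flip inE.
by rewrite (addbACA _ (in_coset z a)) addbACA.
Qed.

Lemma card_dependency (a b : A) : (#|dependency a b| <= 6)%N.
Proof.
pose l := [:: a; a + w; b; b + w; a + b; a + b + w].
apply: leq_trans (card_size l); apply: subset_leq_card; apply/subsetP => z.
have in_cosetE c : in_coset z c = (z == c) || (z == c + w).
  rewrite /in_coset eq_sym; congr orb.
  by rewrite -(inj_eq (addIr w)) addwK eq_sym.
by rewrite !inE !in_cosetE; do 6 case: (z == _).
Qed.

Lemma dependency_shift (s : {ffun A -> bool}) (a b : A) :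
  dependency (shift s a) (shift s b) = dependency a b.
Proof.
apply/setP => z; rewrite !inE /shift !in_coset_mul_w; congr addb.
by rewrite addrACA -mul_wD in_coset_mul_w.
Qed.

End Translation_labels.

(** * Homomorphisms injective on a small set *)

(* Makes products of [finZmodType]s canonically [finZmodType]s. *)
HB.saturate prod.

(** Not a homomorphism: what matters is that it is injective and sends 0 to 0. *)
Definition Z4_bits (x : 'Z_4) : 'Z_2 * 'Z_2 := (inZp x, inZp x./2).

Lemma Z4_bits_inj : injective Z4_bits.
Proof.
apply: (can_inj (g := fun p : 'Z_2 * 'Z_2 => inZp (p.1 + p.2.*2))).
by move=> [[|[|[|[|//]]]] i]; apply/val_inj.
Qed.

(** Two solutions differ by 0 or 2, and adding 2 changes the truth of [x < 2]. *)
Lemma Z4_mul_inj (d x y : 'Z_4) :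
  d != 0 -> d * x = d * y -> (x < 2)%N = (y < 2)%N -> x = y.
Proof.
move: d x y => [[|[|[|[|//]]]] ?] [[|[|[|[|//]]]] ?] [[|[|[|[|//]]]] ?] //= _;
  by move/(congr1 val) => // *; apply/val_inj.
Qed.

Section Separation.

Variable m : nat.

Local Notation A := ('Z_4 * 'rV['Z_4]_m)%type.
Local Notation B := ('Z_2 * 'Z_2 * 'rV['Z_4]_m)%type.

Lemma card_scale_fiber (d : 'Z_4) (u : 'rV['Z_4]_m) :
  d != 0 -> (#|[set v : 'rV['Z_4]_m | d *: v == u]| <= 2 ^ m)%N.
Proof.
move=> d0; pose f (v : 'rV['Z_4]_m) := [ffun i : 'I_m => (v ord0 i < 2)%N].
have -> : (2 ^ m = #|{ffun 'I_m -> bool}|)%N.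
  by rewrite card_ffun card_bool card_ord.
rewrite -(card_in_imset (f := f)) ?max_card // => x y.
rewrite !inE => /eqP <- /eqP e /ffunP fe; apply/rowP => i; rewrite -[0]/ord0.
have := fe i; rewrite !ffunE; apply: Z4_mul_inj d0 _.
by move/rowP/(_ i): e; rewrite !mxE => ->.
Qed.

(** The projection along the cyclic group generated by [(1, v)]. *)
Definition shear (v : 'rV['Z_4]_m) (x : A) : 'rV['Z_4]_m := x.2 - x.1 *: v.

Lemma shearD (v : 'rV['Z_4]_m) : {morph shear v : x y / x + y}.
Proof. by move=> x y; rewrite /shear /= scalerDl opprD addrACA. Qed.

(** A union bound over pairs. Distinct points with equal first coordinates never collide; other
    pairs collide only if [v] solves [d *: v = u] with [d] nonzero, which at most [2 ^ m] of the
    [4 ^ m] vectors do. *)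
Lemma shear_separates (S : {set A}) :
  (#|S| ^ 2 * 2 ^ m < 4 ^ m)%N -> exists v, {in S &, injective (shear v)}.
Proof.
move=> cS.
pose bad := \bigcup_(p in finset.setX S S :\: [set p | p.1 == p.2])
  [set v | shear v p.1 == shear v p.2].
have cbad : (#|bad| <= #|S| ^ 2 * 2 ^ m)%N.
  apply: (@leq_trans (\sum_(p in finset.setX S S :\: [set p | p.1 == p.2]) 2 ^ m)%N);
    last by rewrite sum_nat_const leq_mul2r -mulnn -cardsX subset_leq_card
      ?orbT // subsetDl.
  apply: (@leq_trans (\sum_(p in finset.setX S S :\: [set p | p.1 == p.2])
    #|[set v | shear v p.1 == shear v p.2]|)%N).
    rewrite /bad; elim/big_rec2: _ => [|p n X _ le]; first by rewrite cards0.
    by rewrite (leq_trans (leq_card_setU _ _)) // leq_add2l.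
  apply: leq_sum => -[[x0 x] [y0 y]]; rewrite !inE /= => /andP[neq _].
  case: (x0 =P y0) neq => [->|/eqP ne0 _].
    move=> neq; rewrite eq_card0 // => v; rewrite !inE /shear /=.
    by rewrite (inj_eq (addIr _)); apply: contraNF neq => /eqP ->.
  apply: leq_trans (card_scale_fiber (x - y) (d := x0 - y0) _); last by rewrite subr_eq0.
  apply/eq_leq/eq_card => v; rewrite !inE /shear /= scalerBl.
  by rewrite [RHS]eq_sym !subr_eq -addrA [y + _]addrC [- _ + _]addrC.
have /card_gt0P[v] : (0 < #|~: bad|)%N.
  rewrite cardsCs setCK subn_gt0 (leq_ltn_trans cbad) // card_mx mul1n.
  by rewrite card_ord.
rewrite inE => /bigcupP nbad; exists v => x y xS yS e.
apply/eqP/negPn/negP => ne; apply: nbad; exists (x, y); rewrite !inE /= ?ne ?xS ?yS //.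
exact/eqP.
Qed.

(** * Lifting a shear to a bijection *)

Variable w : 'rV['Z_4]_m.
Hypothesis w2 : w + w = 0.

Local Notation wA := ((0, w) : A).

Section Untwisting.

Variables (S : {set A}) (v : 'rV['Z_4]_m).
Hypotheses (Sw : forall a, a \in S -> a + wA \in S) (S0 : 0 \in S).
Hypothesis shear_inj : {in S &, injective (shear v)}.

Definition offset (g : 'rV['Z_4]_m) : 'Z_4 :=
  if [pick s in S | shear v s == g] is Some s then s.1 else 0.

(* Each fibre of [shear v] is a coset of a copy of Z_4 and meets [S] in at most
   one point; there [untwist] agrees with the homomorphism (0, shear v). *)
Definition untwist (x : A) : B := (Z4_bits (x.1 - offset (shear v x)), shear v x).

Lemma untwist_bij : bijective untwist.
Proof.
apply: inj_card_bij; last by rewrite !card_prod !card_ord.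
move=> x y e; have e2 : shear v x = shear v y by rewrite -[LHS]/((untwist x).2) e.
have /Z4_bits_inj : Z4_bits (x.1 - offset (shear v x)) =
    Z4_bits (y.1 - offset (shear v y)).
  by rewrite -[LHS]/((untwist x).1) e.
rewrite e2 => /addIr e1; move: e2; rewrite /shear e1 => /addIr.
by case: x y e1 {e} => [x0 x] [y0 y] /= -> ->.
Qed.

Lemma offset_shear (s : A) : s \in S -> offset (shear v s) = s.1.
Proof.
move=> sS; rewrite /offset; case: pickP => [t /andP[tS /eqP]|/(_ s)].
  by move/shear_inj => ->.
by rewrite sS eqxx.
Qed.

Lemma untwist_mem (s : A) : s \in S -> untwist s = (0, shear v s).
Proof. by move=> sS; rewrite /untwist offset_shear // subrr; congr pair; apply/eqP. Qed.

Lemma shear_w : shear v wA = w. Proof. by rewrite /shear /= scale0r subr0. Qed.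

(** As [S] is stable under translation by [(0, w)], the fibres over [g] and [g + w] either meet [S]
    in points with the same first coordinate or both take the default 0. *)
Lemma offset_addw (g : 'rV['Z_4]_m) : offset (g + w) = offset g.
Proof.
have step h : [exists s in S, shear v s == h] -> offset (h + w) = offset h.
  case/exists_inP => s sS /eqP <-.
  by rewrite -[in LHS]shear_w -shearD !offset_shear ?Sw //= addr0.
have none h : ~~ [exists s in S, shear v s == h] -> offset h = 0.
  move/exists_inPn => H; rewrite /offset; case: pickP => // s /andP[sS].
  by rewrite (negbTE (H s sS)).
case: (boolP [exists s in S, shear v s == g]) => [/step //|ng].
case: (boolP [exists s in S, shear v s == g + w]) => [/step|/none ->]; last first.
  by rewrite none.
by rewrite -addrA w2 addr0.
Qed.

Lemma untwist_addw (a : A) : untwist (a + wA) = untwist a + (0, w).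
Proof.
by rewrite /untwist shearD shear_w offset_addw /= addr0; congr pair; rewrite /= addr0.
Qed.

Lemma untwist_double (a : A) : untwist a + untwist a = (0, shear v (a + a)).
Proof.
rewrite /untwist shearD; congr pair => /=.
by case: (_ - _) => [[|[|[|[|//]]]] ?]; apply/eqP.
Qed.

(** Generically [a], [b] and [a + b] lie in three distinct cosets, all inside the dependency set,
    hence in [S], where [untwist] is additive. If [a] or [b] is 0 or [wA], only translation by [wA]
    is involved. If [a] and [b] share a coset, their contributions cancel and only the coset of
    [a + b] is known to lie in [S]; this suffices because doubling kills the Z_2 components. *)
Lemma untwist_morph (a b : A) :
  dependency wA a b \subset S -> untwist (a + b) = untwist a + untwist b.
Proof.
have wA2 : wA + wA = 0 by rewrite -[LHS]/(0 + 0, w + w) w2 addr0.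
have untwist0 : untwist 0 = 0 by rewrite untwist_mem // /shear /= scale0r subrr.
have untwist_w : untwist wA = (0, w).
  by rewrite -[wA in LHS]add0r untwist_addw untwist0 add0r.
have untwist_wl x : untwist (wA + x) = untwist wA + untwist x.
  by rewrite addrC untwist_addw untwist_w addrC.
move=> /subsetP sub.
have [->|b0] := eqVneq b 0; first by rewrite untwist0 !addr0.
have [->|a0] := eqVneq a 0; first by rewrite untwist0 !add0r.
have [->|bw] := eqVneq b wA; first by rewrite untwist_addw untwist_w.
have [->|aw] := eqVneq a wA; first by rewrite untwist_wl.
have dup x : dependency wA x x =i in_coset wA ^~ (x + x).
  by move=> z; rewrite inE addbb.
have [eba|ba] := eqVneq b a.
  by rewrite eba untwist_double untwist_mem // sub // eba dup; apply: in_coset_refl.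
have [ebaw|baw] := eqVneq b (a + wA).
  rewrite ebaw untwist_addw !addrA untwist_addw untwist_double untwist_mem // sub // ebaw.
  by rewrite inE addrA !in_coset_addw // addbb in_coset_refl.
have wN : - wA = wA by apply/eqP; rewrite eq_sym -addr_eq0 wA2.
pose N x := in_coset wA 0 x.
have cosetE z x : in_coset wA z x = N (x - z).
  by rewrite /N /in_coset add0r subr_eq0 subr_eq [wA + z]addrC.
have NN x : N (- x) = N x by rewrite /N /in_coset oppr_eq0 add0r eqr_oppLR wN.
have Na : N a = false by rewrite /N /in_coset add0r (negbTE a0) (negbTE aw).
have Nb : N b = false by rewrite /N /in_coset add0r (negbTE b0) (negbTE bw).
have Nba : N (b - a) = false.
  by rewrite -cosetE /in_coset (negbTE ba) (negbTE baw).
have Nab : N (a - b) = false by rewrite -NN opprB.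
have N0 : N 0 by rewrite /N in_coset_refl.
rewrite !untwist_mem; first (by rewrite shearD -[RHS]/(0 + 0, _ + _) addr0);
  apply: sub; rewrite inE !cosetE.
- by rewrite subrr N0 Nab addrK Na.
- by rewrite subrr N0 Nba addrAC subrr add0r Nb.
- rewrite subrr N0 -[N (a - _)]NN -[N (b - _)]NN !opprB.
  by rewrite addrAC subrr add0r addrK Na Nb.
Qed.

End Untwisting.

Lemma separating_bijection (S : {set A}) :
  (forall a, a \in S -> a + wA \in S) -> 0 \in S ->
  (#|S| ^ 2 * 2 ^ m < 4 ^ m)%N ->
  exists2 f : A -> B, bijective f &
    forall a b, dependency wA a b \subset S -> f (a + b) = f a + f b.
Proof.
move=> Sw S0 /shear_separates[v shear_inj].
exists (untwist S v); first exact: untwist_bij.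
exact: untwist_morph.
Qed.

End Separation.

(** * The two groups are not isomorphic *)

(** The equation [x + x = 0] has two solutions in Z_4 but four in Z_2 x Z_2, so the two groups have
    different numbers of solutions. *)
Lemma not_additive_bijection (m : nat)
    (f : 'Z_4 * 'rV['Z_4]_m -> 'Z_2 * 'Z_2 * 'rV['Z_4]_m) :
  bijective f -> ~ {morph f : x y / x + y}.
Proof.
move=> fbij fD.
pose G2 := [set x : 'rV['Z_4]_m | x + x == 0].
have G2_gt0 : (0 < #|G2|)%N by apply/card_gt0P; exists 0; rewrite inE addr0.
have f_inj := bij_inj fbij.
have f0 : f 0 = 0 by apply: (addrI (f 0)); rewrite -fD !addr0.
pose A2 := [set x : 'Z_4 * 'rV['Z_4]_m | x + x == 0].
pose B2 := [set x : 'Z_2 * 'Z_2 * 'rV['Z_4]_m | x + x == 0].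
have AB : f @: A2 = B2.
  case: fbij => g fK gK; apply/setP => y; apply/imsetP/idP => [[x + ->]|].
    by rewrite !inE -fD => /eqP ->; rewrite f0.
  rewrite inE => /eqP y2; exists (g y); rewrite ?gK // inE.
  by apply/eqP/f_inj; rewrite fD gK f0.
have cA : #|A2| = (2 * #|G2|)%N.
  transitivity #|finset.setX [set 0; 2 : 'Z_4] G2|; last by rewrite cardsX cards2.
  congr #|pred_of_set _|; apply/setP => -[x0 x]; rewrite !inE /= xpair_eqE.
  by move: x0 => [[|[|[|[|//]]]] ?].
have cB : #|B2| = (4 * #|G2|)%N.
  transitivity #|finset.setX [set: 'Z_2 * 'Z_2] G2|.
    congr #|pred_of_set _|; apply/setP => -[[x0 x1] x]; rewrite !inE /= !xpair_eqE.
    by move: x0 x1 => [[|[|//]] ?] [[|[|//]] ?].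
  by rewrite cardsX cardsT card_prod card_ord.
have := card_imset (mem A2) f_inj; rewrite AB cA cB => /eqP.
by rewrite eqn_pmul2r.
Qed.

(** * Addition tables under labellings *)

Definition zmod_table (A : zmodType) (n : nat) (p : 'I_n -> A) (q : A -> 'I_n) :
  table n := \matrix_(x, y) q (p x + p y).

Lemma zmod_table_group (A : zmodType) (n : nat) (p : 'I_n -> A) (q : A -> 'I_n) :
  cancel p q -> cancel q p -> is_group_table (zmod_table p q).
Proof.
move=> pK qK; exists (q 0), (fun x => q (- p x)).
split=> [x y z|x|x|x|x]; rewrite !mxE !qK ?addrA ?add0r ?addr0 ?addNr ?subrr //.
Qed.

Lemma zmod_table_isomorphic (A : zmodType) (n : nat)
    (p p' : 'I_n -> A) (q q' : A -> 'I_n) :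
  cancel p q -> cancel q p -> cancel p' q' -> cancel q' p' ->
  isomorphic (zmod_table p q) (zmod_table p' q').
Proof.
move=> pK qK pK' qK'; exists (q' \o p); split.
  by exists (q \o p') => x /=; rewrite ?qK' ?pK ?qK ?pK'.
by move=> x y; rewrite !mxE /= !qK' qK.
Qed.

Lemma additive_of_isomorphic (A B : zmodType) (n : nat)
    (p : 'I_n -> A) (q : A -> 'I_n) (p' : 'I_n -> B) (q' : B -> 'I_n) :
  cancel p q -> cancel q p -> cancel p' q' -> cancel q' p' ->
  isomorphic (zmod_table p q) (zmod_table p' q') ->
  exists2 f : A -> B, bijective f & {morph f : x y / x + y}.
Proof.
move=> pK qK pK' qK' [f [[g fK gK] fM]]; exists (p' \o f \o q).
  by exists (p \o g \o q') => x /=; rewrite ?pK' ?fK ?qK ?pK ?gK ?qK'.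
by move=> x y /=; have := fM (q x) (q y); rewrite !mxE !qK => ->; rewrite qK'.
Qed.

(** * Counting clauses *)

Section Clause_counting.

Variables (K n r : nat) (A : finZmodType) (B : zmodType) (w : A).
Hypotheses (nE : n = (2 ^ K)%N) (cardA : #|A| = n).
Hypotheses (w2 : w + w = 0) (w_neq0 : w != 0).
Hypothesis local_iso : forall S : {set A}, (#|S| <= 6 * r)%N ->
  exists2 f : A -> B, bijective f &
    forall a b, dependency w a b \subset S -> f (a + b) = f a + f b.
Hypothesis not_iso : forall f : A -> B,
  bijective f -> ~ {morph f : x y / x + y}.

Lemma bit_label_add (l : A -> 'I_n) (a : A) (b : bool) (i : 'I_(up_log 2 n)) :
  (forall a, l (a + w) = rev_ord (l a)) ->
  bit (l (a + mul_w w b)) i = bit (l a) i (+) b.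
Proof.
move=> lw; case: b => /=; last by rewrite addr0 addbF.
have lti : (i < K)%N.
  by have := ltn_ord i; rewrite [X in (_ < X)%N -> _](_ : _ = K) // nE up_expnK.
by rewrite lw /= addbT; have := @bit_complement K i (l a) lti; rewrite -nE; apply.
Qed.

Lemma cnf_size_lower_bound (F : cnf (gi_var n)) :
  solves_group_iso F -> (2 ^ r <= cnf_size F)%N.
Proof.
move=> solF.
have [||l [g lK gK] lw] := complementary_labelling (f := fun a => a + w) cardA.
- exact: addwK.
- by move=> a; rewrite -subr_eq0 addrAC subrr add0r.
(* The empty set is enough: any bijection to [B] yields a labelling for the second table. *)
have [|f0 [h f0K hK] _] := local_iso (S := set0); first by rewrite cards0.
pose T2 := zmod_table (f0 \o g) (l \o h).
have T2pK : cancel (f0 \o g) (l \o h) by move=> x /=; rewrite f0K gK.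
have T2qK : cancel (l \o h) (f0 \o g) by move=> x /=; rewrite lK hK.
have T2group : is_group_table T2 by exact: zmod_table_group.
pose T1 s := zmod_table (shift w s \o g) (l \o shift w s).
have T1pK s : cancel (shift w s \o g) (l \o shift w s).
  by move=> x /=; rewrite shiftK.
have T1qK s : cancel (l \o shift w s) (shift w s \o g).
  by move=> x /=; rewrite lK shiftK.
have T1group s : is_group_table (T1 s) by exact: zmod_table_group.
have T1E s x y : T1 s x y = l (g x + g y + mul_w w (defect w s (g x) (g y))).
  by rewrite mxE /= shiftD.
pose p (v : literal (gi_var n)) s :=
  bit (T1 s v.1.1.1.2 v.1.1.2) v.1.2 != v.2.
pose D (v : literal (gi_var n)) := dependency w (g v.1.1.1.2) (g v.1.1.2).
have pflip v z s : p v (flip z s) = p v s (+) (z \in D v).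
  rewrite /p /D !T1E !bit_label_add // defect_flip //.
  by case: (bit _ _) (defect _ _ _ _) (_ \in _) v.2 => [] [] [] [].
pose bad C := [set s | ~~ clause_eval C (encode (T1 s) T2)].
have bad_small C : C \in F -> (#|bad C| * 2 ^ r <= 2 ^ n)%N.
  (* Literals on the second table do not depend on [s]; dropping them can only enlarge the set of
     falsifying [s]. *)
  move=> CF; pose C1 := [set v in C | ~~ v.1.1.1.1].
  have badP s : s \in bad C -> forall v, v \in C -> encode (T1 s) T2 v.1 != v.2.
    by rewrite inE => /exists_inPn H v /H.
  have [|] := fresh_chain C1 pflip (fun v => card_dependency w2 _ _) r; last first.
    rewrite cardA; apply: leq_trans; rewrite leq_mul2r; apply/orP; right.
    apply/subset_leq_card/subsetP => s /badP sC; rewrite inE.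
    apply/forall_inP => -[[[[t x] y] i] b]; rewrite inE => /andP[/sC].
    by case: t.
  case=> S /local_iso[f [f' fK f'K] fD] DS.
  suff -> : bad C = set0 by rewrite cards0.
  apply/setP => s; rewrite [RHS]inE; apply/negP => /badP sC.
  (* Relabelling through [f] gives a table of [B], isomorphic to [T2], so the new pair satisfies
     [C]. A literal true there is also true for [T1 s]: second-table entries are unchanged, and
     first-table entries read by [C] agree by [fD]. *)
  have TpK : cancel (f \o (shift w s \o g)) ((l \o shift w s) \o f').
    by move=> x /=; rewrite fK shiftK.
  have TqK : cancel ((l \o shift w s) \o f') (f \o (shift w s \o g)).
    by move=> x /=; rewrite lK shiftK.
  have [_ /(_ (zmod_table_isomorphic TpK TqK T2pK T2qK))] :=
    solF _ _ (zmod_table_group TpK TqK) T2group.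
  move=> /forall_inP /(_ C CF) /exists_inP[[[[[t x] y] i] b] vC] /eqP vb.
  have := sC _ vC; rewrite -vb /=; case: t vC vb => [vC _|vC _].
    by rewrite eqxx.
  rewrite !mxE /= -fD ?fK ?eqxx //.
  by rewrite dependency_shift //; apply: (DS (false, x, y, i, b)); rewrite inE vC.
(* No pair [T1 s], [T2] is isomorphic, so every [s] falsifies some clause. *)
have cover : (2 ^ n <= \sum_(C in F) #|bad C|)%N.
  rewrite -{1}cardA -card_bool -card_ffun -cardsT.
  apply: (@leq_trans #|\bigcup_(C in F) bad C|).
    apply/subset_leq_card/subsetP => s _; apply/bigcupP.
    have : ~~ cnf_eval F (encode (T1 s) T2).
      apply/negP => /(solF _ _ (T1group s) T2group).
      by case/(additive_of_isomorphic (T1pK s) (T1qK s) T2pK T2qK) => f /not_iso.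
    by case/forall_inPn => C CF nC; exists C => //; rewrite inE.
  elim/big_rec2: _ => [|C j X _ le]; first by rewrite cards0.
  by rewrite (leq_trans (leq_card_setU _ _)) // leq_add2l.
have p2n : (0 < 2 ^ n)%N by rewrite expn_gt0.
rewrite -(leq_pmul2l p2n) (leq_trans (leq_mul cover (leqnn _))) //.
rewrite big_distrl /= mulnC /cnf_size -sum_nat_const; exact: leq_sum.
Qed.

End Clause_counting.

(** * Choice of parameters *)

Lemma cnf_size_ge (k r : nat) (F : cnf (gi_var (2 ^ (2 * k)))) :
  ((2 * (6 * r).+1) ^ 2 * 2 ^ k.-1 < 4 ^ k.-1)%N ->
  solves_group_iso F -> (2 ^ r <= cnf_size F)%N.
Proof.
(* For [k.-1 = 0] the vector [const_mx 2] would be empty, hence zero. *)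
move=> rm; have : (0 < k.-1)%N.
  by case: k.-1 rm => //; rewrite !expn0 muln1 ltnS leqn0 expn_eq0.
case: k F rm => [|[|m]] //= F rm _.
have w0 : (const_mx 2 : 'rV['Z_4]_m.+1) + const_mx 2 = 0.
  by apply/rowP => i; rewrite !mxE; apply/eqP.
pose w : 'Z_4 * 'rV['Z_4]_m.+1 := (0, const_mx 2).
have w2 : w + w = 0 by rewrite -[LHS]/(0 + 0, _ + _) w0 addr0.
apply: (@cnf_size_lower_bound (2 * m.+2) _ r _
  ('Z_2 * 'Z_2 * 'rV['Z_4]_m.+1)%type w) => //.
- by rewrite card_prod card_mx card_ord mul1n -expnS expnM.
- apply/eqP => /(congr1 (fun x : 'Z_4 * 'rV['Z_4]_m.+1 => x.2 ord0 ord0)).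
  by rewrite !mxE.
- move=> S cS.
  (* Adding 0 accounts for the successor in [2 * (6 * r).+1], closing under [w] for the factor 2. *)
  pose S0 := 0 |: S; pose S1 := S0 :|: [set a + w | a in S0].
  have [||//|f fbij fD] := separating_bijection (S := S1) w0.
  + move=> a /setUP[aS|/imsetP[b bS ->]]; apply/setUP.
      by right; apply/imsetP; exists a.
    by left; rewrite addwK.
  + by rewrite !inE eqxx.
  + apply: leq_ltn_trans rm; rewrite leq_mul2r leq_sqr; apply/orP; right.
    have cS0 : (#|S0| <= (6 * r).+1)%N.
      by rewrite (leq_trans (leq_card_setU _ _)) // cards1 ltnS.
    rewrite (leq_trans (leq_card_setU _ _)) // mul2n -addnn leq_add //.
    exact: leq_trans (leq_imset_card _ _) cS0.
  exists f => // a b sub; apply: fD; apply: subset_trans sub _.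
  by apply/subsetP => x xS; rewrite !inE xS !orbT.
- exact: not_additive_bijection.
Qed.

Lemma pow4_lt_exp2 (k : nat) : (32 <= k)%N -> (k ^ 4 * 2 ^ 9 < 2 ^ k)%N.
Proof.
elim: k => // k IHk; rewrite leq_eqVlt => /predU1P[<-|].
  by rewrite -[32%N]/(2 ^ 5)%N -expnM -expnD ltn_exp2l.
rewrite ltnS => k32; apply: (@leq_ltn_trans (2 * (k ^ 4 * 2 ^ 9))%N).
  rewrite mulnA leq_mul2r; apply/orP; right.
  (* The ratio 7/5 is just below the square root of 2, so squaring the next inequality gives
     [k.+1 ^ 4 <= 2 * k ^ 4]. *)
  rewrite -[4%N]/(2 * 2)%N !expnM.
  have : (5 * k.+1 ^ 2 <= 7 * k ^ 2)%N by rewrite -!mulnn; nia.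
  by move: (k.+1 ^ 2)%N (k ^ 2)%N => x y; rewrite -!mulnn; nia.
by rewrite [ltnRHS]expnS ltn_pmul2l // IHk.
Qed.

Theorem theorem4p3 (R : realType) :
  exists2 c : R, 0 < c &
  exists k0 : nat, forall k : nat, (k0 <= k)%N ->
  let n := (2 ^ (2 * k))%N in
  forall F : cnf (gi_var n), solves_group_iso F ->
  n%:R `^ (c * ln n%:R) <= (cnf_size F)%:R :> R.
Proof.
have ln2_gt0 : 0 < ln (2%:R : R) by rewrite ln_gt0 // ltr1n.
(* Since [ln n = 2 * k * ln 2], this constant makes the bound exactly [2 ^ (k ^ 2)]. *)
exists (4%:R * ln 2%:R)^-1; first by rewrite invr_gt0 mulr_gt0.
exists 32%N => k k32 n F solF.
have -> : n%:R `^ ((4%:R * ln 2%:R)^-1 * ln n%:R) = (2 ^ (k ^ 2))%:R :> R.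
  have n0 : 0 < n%:R :> R by rewrite ltr0n expn_gt0.
  have lnn : ln n%:R = (2 * k)%:R * ln 2%:R :> R.
    by rewrite /n natrX lnXn // mulr_natl.
  rewrite /powR gt_eqF // lnn.
  have -> : (4%:R * ln 2%:R)^-1 * ((2 * k)%:R * ln 2%:R) * ((2 * k)%:R * ln 2%:R)
      = (k ^ 2)%:R * ln 2%:R :> R.
    by rewrite natrX natrM; field; rewrite gt_eqF.
  by rewrite expRM_natl lnK ?natrX // posrE.
(* Here [r = k ^ 2]: [(2 * (6 * r + 1)) ^ 2] is at most [196 * k ^ 4], while [pow4_lt_exp2] gives
   [256 * k ^ 4 < 2 ^ (k - 1)]. *)
rewrite ler_nat; apply: cnf_size_ge solF.
case: k k32 {n F} => // k k32; rewrite succnK.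
rewrite -[4%N]/(2 * 2)%N [ltnRHS]expnMn.
rewrite ltn_pmul2r ?expn_gt0 //.
have := pow4_lt_exp2 k32; rewrite -[4%N]/(2 * 2)%N expnM [ltnRHS]expnS.
have : (0 < k.+1 ^ 2)%N by rewrite expn_gt0.
move: (k.+1 ^ 2)%N (2 ^ k)%N => x y; rewrite -!mulnn -[(2 ^ 9)%N]/512%N; nia.
Qed.
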